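(* Let $(X,d)$ be a metric space. Suppose that one of the following holds: (i) $(X,d)$ is complete and locally compact; (ii) $(X,d)$ is complete and $(d_0)_0=d_0$; (iii) $(X,d)$ is a length space, that is, $\bar d=d$. Then $d_0=\bar d$. Moreover, if (i) holds then $(X,d_0)$ is a geodesic space, i.e., for any $p,q\in X$ with $d_0(p,q)<\infty$ there exists a $d_0$-continuous path $\gamma\colon[0,1]\to X$ joining $p$ to $q$ whose $d_0$-length equals $d_0(p,q)$.
   Context: Metrics are allowed to take the value $\infty$ (all other metric axioms are as usual; topology, completeness, etc. are defined as usual). For $n\in\mathbb{N}^+$, $[n]=\{1,\dots,n\}$. Let $(X,d)$ be a metric space. Length metric: the $d$-length of a $d$-continuous path $\gamma\colon[0,1]\to X$ is $L(\gamma)=\sup\sum_{k=1}^n d(\gamma(t_{k-1}),\gamma(t_k))$, the supremum being over all finite partitions $0=t_0<t_1<\dots<t_n=1$. The length metric induced by $d$ is $\bar d(p,q)=\inf\{L(\gamma): \gamma\colon[0,1]\to X \text{ is a } d\text{-continuous path joining } p \text{ to } q\}$, with $\inf\emptyset=\infty$. The metric $d_0$: for $\varepsilon>0$, an $\varepsilon$-chain joining $p$ to $q$ is a finite string $c=(x_0,\dots,x_n)$ of points of $X$ ($n\in\mathbb{N}^+$) with $x_0=p$, $x_n=q$ and $d(x_{k-1},x_k)\le\varepsilon$ for all $k\in[n]$; its length is $L(c)=\sum_{k=1}^n d(x_{k-1},x_k)$. Set $d_\varepsilon(p,q)=\inf\{L(c): c\text{ is an }\varepsilon\text{-chain joining }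 p\text{ to } q\}\in[0,\infty]$ and $d_0(p,q)=\sup_{\varepsilon>0}d_\varepsilon(p,q)=\lim_{\varepsilon\to0}d_\varepsilon(p,q)$. This is a metric on $X$ with values in $[0,\infty]$. The metric $(d_0)_0$ is obtained by applying the same construction to $(X,d_0)$. The $d_0$-length of a $d_0$-continuous path $\gamma\colon[0,1]\to X$ is $\sup\sum_{k=1}^n d_0(\gamma(t_{k-1}),\gamma(t_k))$, the supremum being over all finite partitions $0=t_0<t_1<\dots<t_n=1$. *)

(* Defs.v *)
From HB Require Import structures.
From mathcomp Require Import all_boot all_order all_algebra.
From mathcomp Require Import all_classical all_reals all_analysis.
Set Implicit Arguments.
Unset Strict Implicit.
Unset Printing Implicit Defensive.
Import Order.TTheory GRing.Theory Num.Theory.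
Import numFieldNormedType.Exports.
Local Open Scope classical_set_scope.
Local Open Scope ring_scope.
Local Open Scope ereal_scope.

Record emetric (R : realType) (X : Type) := EMetric {
  emetric_fun :> X -> X -> \bar R;
  emetric_ge0 : forall x y, 0 <= emetric_fun x y;
  emetric_eq0 : forall x y, emetric_fun x y = 0 <-> x = y;
  emetric_sym : forall x y, emetric_fun x y = emetric_fun y x;
  emetric_triangle : forall y x z,
    emetric_fun x z <= emetric_fun x y + emetric_fun y z
}.

(* The type [X] with the topology and uniformity of [d]; the alias allows
   several metrics on the same [X]. *)
Definition emetric_space (R : realType) (X : Type) (d : emetric R X) : Type :=
  X.

Section emetric_space_instances.
Context (R : realType) (X : Type) (d : emetric R X).

Let T := emetric_space d.

HB.instance Definition _ := gen_eqMixin T.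
HB.instance Definition _ := gen_choiceMixin T.

Definition emetric_ball (x : T) (e : R) : set T := [set y | d x y < e%:E].

Let ent : set_system (T * T) := entourage_ emetric_ball.

Let nbhs_ball (x : T) : set_system T := nbhs_ ent x.

HB.instance Definition _ := hasNbhs.Build T nbhs_ball.

Let nbhsE : nbhs = nbhs_ ent. Proof. by []. Qed.

Let ball_center (x : T) (e : R) : (0 < e)%R -> emetric_ball x e x.
Proof. by move=> e0; rewrite /emetric_ball/= (emetric_eq0 d x x).2 ?lte_fin. Qed.

Let ball_sym (x y : T) (e : R) : emetric_ball x e y -> emetric_ball y e x.
Proof. by rewrite /emetric_ball/= emetric_sym. Qed.

Let ball_triangle (x y z : T) (e1 e2 : R) :
  emetric_ball x e1 y -> emetric_ball y e2 z -> emetric_ball x (e1 + e2)%R z.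
Proof.
rewrite /emetric_ball/= => xy yz; rewrite EFinD.
by apply: le_lt_trans (emetric_triangle d y x z) _; exact: lteD.
Qed.

Let entourageE : ent = entourage_ emetric_ball. Proof. by []. Qed.

HB.instance Definition _ := @Nbhs_isPseudoMetric.Build R T
  ent nbhsE emetric_ball ball_center ball_sym ball_triangle entourageE.

End emetric_space_instances.

Definition emetric_complete (R : realType) (X : Type) (d : emetric R X) :=
  forall u : nat -> emetric_space d,
    cauchy (u @ \oo) -> exists l : emetric_space d, u @ \oo --> l.

(* The length of the string [x :: s]. *)
Definition string_length (R : realType) (X : Type) (d : X -> X -> \bar R)
    (x : X) (s : seq X) : \bar R :=
  \sum_(e <- pairmap d x s) e.

Definition path_length (R : realType) (X : Type) (d : X -> X -> \bar R)
    (g : R -> X) : \bar R :=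
  ereal_sup [set string_length d (g 0%R) (map g t) |
             t in [set t | itv_partition 0%R 1%R t]].

(* Paths are functions on the whole of [R]; only their restriction to [0, 1]
   matters. *)
Definition joining_path (R : realType) (X : Type) (d : emetric R X) (p q : X) :
    set (R -> X) :=
  [set g : R -> emetric_space d | {within `[0%R, 1%R], continuous g} /\
                                  (g 0%R = p /\ g 1%R = q)].

Definition length_dist (R : realType) (X : Type) (d : emetric R X) (p q : X) :
    \bar R :=
  ereal_inf [set path_length d g | g in joining_path d p q].

(* [p :: s] is an [eps]-chain from [p] to [q]. *)
Definition eps_chain (R : realType) (X : Type) (d : X -> X -> \bar R) (eps : R)
    (p q : X) : set (seq X) :=
  [set s | [/\ (0 < size s)%N, path (fun x y => d x y <= eps%:E) p s
             & last p s = q]].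

Definition eps_dist (R : realType) (X : Type) (d : X -> X -> \bar R) (eps : R)
    (p q : X) : \bar R :=
  ereal_inf [set string_length d p s | s in eps_chain d eps p q].

Definition chain_dist (R : realType) (X : Type) (d : X -> X -> \bar R)
    (p q : X) : \bar R :=
  ereal_sup [set eps_dist d eps p q | eps in [set eps : R | (0 < eps)%R]].

Section chain_metric.
Context (R : realType) (X : Type) (d : emetric R X).
Implicit Types (x y z p q r : X) (s : seq X) (eps : R).

Lemma string_length_ge0 x s : 0 <= string_length d x s.
Proof.
rewrite /string_length; elim: s x => [|y s IHs] x /=; first by rewrite big_nil.
by rewrite big_cons adde_ge0// emetric_ge0.
Qed.

Lemma string_length_ge x s : d x (last x s) <= string_length d x s.
Proof.
rewrite /string_length; elim: s x => [|y s IHs] x /=.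
  by rewrite big_nil (emetric_eq0 d x x).2.
rewrite big_cons; apply: le_trans (emetric_triangle d y _ _) _.
exact: leeD.
Qed.

Lemma string_length_cat x s s' :
  string_length d x (s ++ s') =
  string_length d x s + string_length d (last x s) s'.
Proof. by rewrite /string_length pairmap_cat big_cat. Qed.

Lemma string_length_rev x s :
  string_length d (last x s) (rev (belast x s)) = string_length d x s.
Proof.
elim: s x => //= y s IHs x; rewrite rev_cons -cats1 string_length_cat IHs.
have -> : last (last y s) (rev (belast y s)) = y.
  by case: s {IHs} => //= z s; rewrite rev_cons last_rcons.
by rewrite /string_length /= !big_cons big_nil adde0 addeC emetric_sym.
Qed.

Lemma eps_chain_rev eps p q s :
  eps_chain d eps p q s -> eps_chain d eps q p (rev (belast p s)).
Proof.
case=> s0 ps <-; split; first by rewrite size_rev size_belast.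
  rewrite rev_path; move: ps; congr is_true; apply: eq_path => x y /=.
  by rewrite emetric_sym.
by case: s s0 {ps} => //= z s _; rewrite rev_cons last_rcons.
Qed.

Lemma eps_chain_cat eps p q r s s' :
  eps_chain d eps p q s -> eps_chain d eps q r s' ->
  eps_chain d eps p r (s ++ s').
Proof.
move=> [s0 ps <-] [s'0 ps' <-]; split; last by rewrite last_cat.
  by rewrite size_cat addn_gt0 s0.
by rewrite cat_path ps.
Qed.

Lemma eps_dist_ge0 eps p q : 0 <= eps_dist d eps p q.
Proof.
by apply: le_ereal_inf_tmp => _ [s _ <-]; exact: string_length_ge0.
Qed.

Lemma eps_dist_ge eps p q : d p q <= eps_dist d eps p q.
Proof.
by apply: le_ereal_inf_tmp => _ [s [_ _ <-] <-]; exact: string_length_ge.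
Qed.

Lemma eps_distxx eps p : (0 < eps)%R -> eps_dist d eps p p = 0.
Proof.
move=> eps0; apply/eqP; rewrite eq_le eps_dist_ge0 andbT.
have dpp : d p p = 0 by exact/emetric_eq0.
apply: ereal_inf_lbound; exists [:: p].
  by split => //=; rewrite dpp lee_fin ltW.
by rewrite /string_length/= big_cons big_nil dpp adde0.
Qed.

Lemma eps_dist_le_sym eps p q : eps_dist d eps p q <= eps_dist d eps q p.
Proof.
apply: le_ereal_inf_tmp => _ [s sqp <-]; apply: ereal_inf_lbound.
exists (rev (belast q s)); first exact: eps_chain_rev.
by case: sqp => _ _ <-; exact: string_length_rev.
Qed.

Lemma eps_dist_triangle eps q p r :
  eps_dist d eps p r <= eps_dist d eps p q + eps_dist d eps q r.
Proof.
have step s : eps_chain d eps p q s ->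
    eps_dist d eps p r <= string_length d p s + eps_dist d eps q r.
  move=> spq; have := string_length_ge0 p s.
  case E : (string_length d p s) => [l| |] // _; last first.
    by rewrite addye ?leey// gt_eqF// (lt_le_trans _ (eps_dist_ge0 _ _ _)).
  rewrite -leeBlDl//; apply: le_ereal_inf_tmp => _ [s' sqr <-].
  rewrite leeBlDl// -E; apply: ereal_inf_lbound; exists (s ++ s').
    exact: eps_chain_cat spq sqr.
  by rewrite string_length_cat; case: spq => _ _ ->.
have := eps_dist_ge0 eps q r.
case E : (eps_dist d eps q r) => [l| |] // _; last first.
  by rewrite addey ?leey// gt_eqF// (lt_le_trans _ (eps_dist_ge0 _ _ _)).
rewrite -leeBlDr//; apply: le_ereal_inf_tmp => _ [s spq <-].
by rewrite leeBlDr// -E; exact: step.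
Qed.

Lemma chain_dist_ge p q : d p q <= chain_dist d p q.
Proof.
apply: le_trans (eps_dist_ge 1 p q) _.
by apply: ereal_sup_ubound; exists 1%R => //=.
Qed.

Lemma chain_dist_ge0 p q : 0 <= chain_dist d p q.
Proof. exact: le_trans (emetric_ge0 d p q) (chain_dist_ge p q). Qed.

Lemma chain_dist_eq0 p q : chain_dist d p q = 0 <-> p = q.
Proof.
split=> [pq0|->].
  apply/(emetric_eq0 d)/eqP; rewrite eq_le emetric_ge0 andbT -pq0.
  exact: chain_dist_ge.
apply/eqP; rewrite eq_le chain_dist_ge0 andbT.
by apply: ge_ereal_sup => _ [eps eps0 <-]; rewrite eps_distxx.
Qed.

Lemma chain_dist_sym p q : chain_dist d p q = chain_dist d q p.
Proof.
congr ereal_sup; apply: eq_imagel => eps _.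
by apply/eqP; rewrite eq_le !eps_dist_le_sym.
Qed.

Lemma chain_dist_triangle q p r :
  chain_dist d p r <= chain_dist d p q + chain_dist d q r.
Proof.
apply: ge_ereal_sup => _ [eps eps0 <-].
apply: le_trans (eps_dist_triangle eps q p r) _.
by apply: leeD; apply: ereal_sup_ubound; exists eps.
Qed.

Definition chain_emetric : emetric R X :=
  EMetric chain_dist_ge0 chain_dist_eq0 chain_dist_sym chain_dist_triangle.

End chain_metric.

Definition geodesic (R : realType) (X : Type) (d : emetric R X) :=
  forall p q : X, d p q < +oo ->
    exists2 g : R -> X, joining_path d p q g & path_length d g = d p q.

(* Main.v *)
(* Any [d]-path can be cut into steps of [d]-size at most [eps], so [d_0] never
   exceeds the length metric. Conversely one builds paths that are Lipschitz
   for [d_0] as pointwise limits of coarse paths; this suffices because [d_0]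
   is lower semicontinuous for [d].

   If [X] is complete and locally compact, take for each [eps > 0] a nearly
   optimal [eps]-chain from [p] to [q], parametrized by its length, and an
   ultrafilter converging to [eps = 0]. The set of times at which the chains
   converge along the ultrafilter is closed by completeness and open by local
   compactness, so it is the whole line. The limit has [d_0]-length
   [d_0(p, q)].

   If [X] is complete and [(d_0)_0 = d_0], then [d_0(x, y) < L] yields a point
   [z] with [d_0(x, z) < L / 2] and [d_0(z, y) < L / 2], and iterated bisection
   gives maps that converge to an [L]-Lipschitz path. *)
Require Import Defs.
From HB Require Import structures.
From mathcomp Require Import all_boot all_order all_algebra.
From mathcomp Require Import all_classical all_reals all_analysis.
From mathcomp Require Import lra.
Import Order.TTheory GRing.Theory Num.Theory.
Import numFieldNormedType.Exports.
Local Open Scope classical_set_scope.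

Section chain_distance.
Set Implicit Arguments.
Unset Strict Implicit.
Unset Printing Implicit Defensive.
Local Open Scope ring_scope.

(** * Elementary estimates for [eps_dist], and limits along filters *)

Section emetric_theory.
Context (R : realType) (X : Type).
Implicit Types (d : emetric R X) (x y z p q : X) (a b e s t M L : R).

Lemma emetricxx d x : d x x = 0%E.
Proof. exact/emetric_eq0. Qed.

Lemma emetric_triangle_le d y x z a b :
  (d x y <= a%:E)%E -> (d y z <= b%:E)%E -> (d x z <= (a + b)%:E)%E.
Proof.
by move=> xy yz; rewrite EFinD (le_trans (emetric_triangle d y x z))// leeD.
Qed.

Lemma eps_dist_triangle_le d e y x z a b :
  (eps_dist d e x y <= a%:E)%E -> (eps_dist d e y z <= b%:E)%E ->
  (eps_dist d e x z <= (a + b)%:E)%E.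
Proof.
by move=> xy yz; rewrite EFinD (le_trans (eps_dist_triangle d e y x z))// leeD.
Qed.

Lemma eps_dist_le d e x y : (d x y <= e%:E)%E -> (eps_dist d e x y <= d x y)%E.
Proof.
move=> xye; apply: ereal_inf_lbound; exists [:: y].
  by split=> //=; rewrite xye.
by rewrite /string_length/= big_cons big_nil adde0.
Qed.

Lemma le_eps_dist d e e' x y : e <= e' ->
  (eps_dist d e' x y <= eps_dist d e x y)%E.
Proof.
move=> ee'; apply: ereal_inf_le_tmp => _ [s [s0 xs sy] <-].
exists s => //; split=> //.
by apply: sub_path xs => u v /le_trans; apply; rewrite lee_fin.
Qed.

Lemma eps_dist_le_chain d e x y : 0 < e ->
  (eps_dist d e x y <= chain_dist d x y)%E.
Proof. by move=> e0; apply: ereal_sup_ubound; exists e. Qed.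

Lemma emetric_ballE d (x y : emetric_space d) e : ball x e y = (d x y < e%:E)%E.
Proof. by []. Qed.

(* [eps_dist d e] is continuous for [d], as nearby points are joined by a
   single step; hence [chain_dist d] is lower semicontinuous. *)
Lemma chain_dist_lim d I (F : set_system I) {FF : ProperFilter F}
    (u v : I -> emetric_space d) x y M :
  u @ F --> (x : emetric_space d) -> v @ F --> (y : emetric_space d) ->
  (forall e eta, 0 < e -> 0 < eta ->
    \forall i \near F, (eps_dist d e (u i) (v i) <= (M + eta)%:E)%E) ->
  (chain_dist d x y <= M%:E)%E.
Proof.
move=> /cvg_ballP ux /cvg_ballP vy uv; apply: ge_ereal_sup => _ [e /= e0 <-].
apply/lee_addgt0Pr => eta eta0; rewrite -EFinD.
(* Points closer than [k] are joined by one [e]-step of cost at most [eta / 3]. One such step at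
   each end and the slack of the hypothesis add up to [eta]. *)
pose k := Num.min e (eta / 3).
have k0 : 0 < k by rewrite lt_min e0 divr_gt0.
have [ke keta] : k <= e /\ k <= eta / 3 by rewrite !ge_min !lexx orbT.
have eta3 : 0 < eta / 3 by rewrite divr_gt0.
have [i [[xui yvi] uvi]] :=
  filter_ex (filterI (filterI (ux _ k0) (vy _ k0)) (uv e _ e0 eta3)).
have near_le (z w : X) : (d z w < k%:E)%E ->
    (eps_dist d e z w <= (eta / 3)%:E)%E.
  move=> zw; apply: le_trans (eps_dist_le _) _.
    by apply: le_trans (ltW zw) _; rewrite lee_fin.
  by apply: le_trans (ltW zw) _; rewrite lee_fin.
have viy : (eps_dist d e (v i) y <= (eta / 3)%:E)%E.
  by apply: near_le; rewrite emetric_sym.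
apply: le_trans (eps_dist_triangle_le (near_le _ _ xui)
  (eps_dist_triangle_le uvi viy)) _.
by rewrite lee_fin; lra.
Qed.

(** This is lower semicontinuity with bound 0 and both families equal to [u]. *)
Lemma emetric_cvg_unique d I (F : set_system I) {FF : ProperFilter F}
    (u : I -> emetric_space d) (x y : emetric_space d) :
  u @ F --> x -> u @ F --> y -> x = y.
Proof.
move=> ux uy; apply/(chain_dist_eq0 d)/eqP; rewrite eq_le chain_dist_ge0 andbT.
apply: (chain_dist_lim ux uy) => e eta e0 eta0.
by apply: nearW => i; rewrite eps_distxx// lee_fin add0r ltW.
Qed.

(** Completeness is stated for sequences. Centres of balls of radius 1/(n+1) that belong to [G] form
    a Cauchy sequence, as any two such balls meet, and [G] converges to its limit. *)
Lemma complete_cauchy_ex d (G : set_system (emetric_space d)) :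
  emetric_complete d -> ProperFilter G -> cauchy_ex G ->
  exists l : emetric_space d, G --> l.
Proof.
move=> dC GF Gc.
have /choice[u Gu] (n : nat) :
    exists x : emetric_space d, G (ball x n.+1%:R^-1).
  exact/Gc.
have un m n : (m <= n)%N -> ball (u m) (m.+1%:R^-1 + m.+1%:R^-1) (u n).
  move=> mn; have [z [umz unz]] := filter_ex (filterI (Gu m) (Gu n)).
  apply: ball_triangle umz _; apply: le_ball (ball_sym unz).
  by rewrite lef_pV2 ?posrE// ler_nat.
have small e : 0 < e -> exists n : nat, n.+1%:R^-1 < e.
  move=> e0; have [n _ ne] := near_infty_natSinv_lt (PosNum e0).
  by exists n; exact: (ne n (leqnn n)).
have [|l ul] := dC u.
  apply: cauchy_exP => e e0; have [|m me] := small (e / 2).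
    by rewrite divr_gt0.
  exists (u m); exists m => // n /= mn; apply: le_ball (un _ _ mn).
  by rewrite [e]splitr lerD// ltW.
exists l; apply/fcvg_ballP => e e0.
have e2 : 0 < e / 2 by rewrite divr_gt0.
have [m _ um] := (cvg_ballP _ _).1 ul _ e2.
have [n ne] := small _ e2.
pose k := maxn m n.
have := um k (leq_maxl _ _); rewrite /= => luk.
apply: filterS (Gu k) => z ukz; rewrite [e]splitr; apply: ball_triangle luk _.
apply: le_ball ukz; apply: le_trans (ltW ne).
by rewrite lef_pV2 ?posrE// ler_nat ltnS leq_maxr.
Qed.

(** Compactness gives a cluster point. If one of its neighbourhoods were not in the ultrafilter, the
    complement would be, against clustering. *)
Lemma ultra_compact_cvg (T : topologicalType) I (F : set_system I) (K : set T)
    (f : I -> T) : UltraFilter F -> compact K ->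
  (\forall i \near F, K (f i)) -> exists l : T, f @ F --> l.
Proof.
move=> FU cK fK; have [l [_ lF]] := cK (f @ F) _ fK.
exists l => A lA; have [//|FA] := in_ultra_setVsetC (f @^-1` A) FU.
by have [w []] := lF (~` A) A FA lA.
Qed.

(** * Lipschitz paths and their length *)

Lemma string_length_lipschitz d (g : R -> X) M a (t : seq R) :
  (forall s t, s <= t -> (d (g s) (g t) <= (M * (t - s))%:E)%E) ->
  path <%R a t ->
  (string_length d (g a) (map g t) <= (M * (last a t - a))%:E)%E.
Proof.
move=> gM; elim: t a => [|b t IHt] a /=.
  by rewrite /string_length/= big_nil subrr mulr0.
move=> /andP[ab bt]; rewrite /string_length/= big_cons.
apply: le_trans (leeD (gM _ _ (ltW ab)) (IHt _ bt)) _.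
by rewrite -EFinD lee_fin -mulrDr addrC addrA subrK.
Qed.

Lemma lipschitz_joining_path d (g : R -> X) M :
  (forall s t, s <= t -> (d (g s) (g t) <= (M * (t - s))%:E)%E) ->
  joining_path d (g 0) (g 1) g /\ (path_length d g <= M%:E)%E.
Proof.
move=> gM.
have M0 : 0 <= M.
  rewrite -lee_fin; apply: le_trans (emetric_ge0 d (g 0) (g 1)) _.
  by rewrite (le_trans (gM _ _ ler01))// subr0 mulr1.
split.
  split=> //; apply: continuous_subspaceT => t; apply/cvg_ballP => e e0.
  (* [M] may be 0, so the modulus of continuity divides by [M + 1]. *)
  have M1 : 0 < M + 1 by lra.
  have eM : 0 < e / (M + 1) by rewrite divr_gt0.
  apply: filterS (nbhsx_ballx t _ eM) => s.
  rewrite -ball_normE /ball_ /= ltr_pdivlMr// => ts; rewrite emetric_ballE.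
  wlog st : s t ts / s <= t => [H|].
    have [/H|/ltW ts'] := leP s t; first exact.
    by rewrite emetric_sym; apply: H => //; rewrite distrC.
  rewrite emetric_sym; apply: le_lt_trans (gM _ _ st) _.
  rewrite lte_fin; apply: le_lt_trans ts.
  by rewrite ger0_norm ?subr_ge0// mulrC ler_wpM2l ?subr_ge0//; lra.
apply: ge_ereal_sup => _ [t [tlt /eqP t1] <-].
by apply: le_trans (string_length_lipschitz gM tlt) _; rewrite t1 subr0 mulr1.
Qed.

Lemma le_path_length d p q (g : R -> X) :
  joining_path d p q g -> (d p q <= path_length d g)%E.
Proof.
move=> [_ [<- <-]]; apply: ereal_sup_ge.
exists (string_length d (g 0) [:: g 1]).
  by exists [:: 1] => //=; split=> //=; rewrite ltr01.
by rewrite /string_length/= big_cons big_nil adde0.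
Qed.

(** The maps [c i] may jump; [eta] absorbs the jumps and disappears in the limit. Convergence is for
    [d] only, but bounds on [eps_dist d e] for every [e] pass to [chain_dist] by lower
    semicontinuity. *)
Lemma limit_path d I (F : set_system I) {FF : ProperFilter F}
    (c : I -> R -> emetric_space d) M (p q : emetric_space d) :
  (forall t, exists z : emetric_space d, c^~ t @ F --> z) ->
  c^~ 0 @ F --> p -> c^~ 1 @ F --> q ->
  (forall e eta, 0 < e -> 0 < eta -> \forall i \near F,
    forall s t, s <= t ->
      (eps_dist d e (c i s) (c i t) <= (M * (t - s) + eta)%:E)%E) ->
  exists g : R -> X, [/\ g 0 = p, g 1 = q &
    forall s t, s <= t -> (chain_dist d (g s) (g t) <= (M * (t - s))%:E)%E].
Proof.
move=> /choice[g cg] cp cq cM; exists g; split.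
- exact: emetric_cvg_unique (cg 0) cp.
- exact: emetric_cvg_unique (cg 1) cq.
- move=> s t st; apply: (chain_dist_lim (cg s) (cg t)) => e eta e0 eta0.
  by apply: filterS (cM _ _ e0 eta0) => i; exact.
Qed.

Lemma length_dist_le d p q (g : R -> X) M :
  g 0 = p -> g 1 = q ->
  (forall s t, s <= t -> (chain_dist d (g s) (g t) <= (M * (t - s))%:E)%E) ->
  (length_dist d p q <= M%:E)%E.
Proof.
move=> <- <- gM; have [|gj] := @lipschitz_joining_path d g M.
  by move=> s t /gM; apply: le_trans; exact: chain_dist_ge.
by apply: le_trans; apply: ereal_inf_lbound; exists g.
Qed.

(** * The chain distance is at most the length of any joining path *)

Lemma fine_partition (D : R) a b (n : nat) : 0 < D -> a < b ->
  b - a < n%:R * D ->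
  exists t : seq R, itv_partition a b t /\
    path (fun u v => [&& a <= u, u <= v, v < u + 2 * D & v <= b]) a t.
Proof.
move=> D0; elim: n a => [|n IHn] a ab; first by rewrite mul0r; lra.
rewrite -natr1 mulrDl mul1r => abn.
(* Steps of length [D] are cut off while at least [2 * D] remains, so the final step is positive and
   shorter than [2 * D]. *)
have [baD|Dba] := ltP (b - a) (2 * D).
  exists [:: b]; split; first exact: itv_partition1.
  by rewrite /= !lexx ltW//= andbT; lra.
have [||t [[tp tb] tD]] := IHn (a + D); [lra|lra|].
exists (a + D :: t); split; first by split=> //=; rewrite tp andbT; lra.
rewrite /=; apply/andP; split; first by rewrite lexx/=; lra.
by apply: sub_path tD => u v /and4P[au -> -> ->]; rewrite !andbT; lra.
Qed.

Lemma chain_dist_le_path_length d p q (g : R -> X) :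
  joining_path d p q g -> (chain_dist d p q <= path_length d g)%E.
Proof.
move=> [gC [gp gq]]; apply: ge_ereal_sup => _ [e /= e0 <-].
(* Uniform continuity of [g] on [0, 1], from compactness in its near-covering form. *)
have [D D0 gD] : exists2 D : R, 0 < D &
    forall s t, 0 <= s <= 1 -> 0 <= t <= 1 ->
    `|s - t| < D -> (d (g s) (g t) <= e%:E)%E.
  have /compact_near_coveringP/near_covering_withinP K01 :=
    @segment_compact R 0 1.
  pose P (D s : R) := forall t, 0 <= t <= 1 ->
    `|s - t| < D -> (d (g s) (g t) <= e%:E)%E.
  have : \forall D \near 0^'+, `[0%R, 1%R] `<=` P D.
    apply: K01 => x x01.
    have e2 : 0 < e / 2 by rewrite divr_gt0.
    have /cvg_ballP/(_ _ e2) := (subspace_continuousP _ _).1 gC x x01.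
    move=> /nbhs_ballP[D /= D0 xD].
    exists (ball x (D / 2), [set i | i < D / 2]).
      split; first by apply: nbhsx_ballx; rewrite divr_gt0.
      by apply: nbhs_right_lt; rewrite divr_gt0.
    move=> [s i] /= [xs iD] s01 t t01 st.
    rewrite -ball_normE /ball_ /= in xs.
    have gx u : `|x - u| < D -> 0 <= u <= 1 -> (d (g x) (g u) <= (e / 2)%:E)%E.
      move=> xu u01; apply/ltW/(xD u); first by rewrite -ball_normE.
      by rewrite /= in_itv.
    rewrite [e]splitr; apply: (@emetric_triangle_le d (g x)).
      rewrite emetric_sym; apply: gx => //.
      by apply: lt_trans xs _; lra.
    apply: gx => //; rewrite -(subrKA s); apply: le_lt_trans (ler_normD _ _) _.
    by rewrite [D]splitr ltrD// (lt_trans st).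
  move=> /(filterI (nbhs_right_gt 0))/filter_ex[D [D0 gD]].
  by exists D => // s t s01; apply: gD; rewrite /= in_itv.
have D2 : 0 < D / 2 by rewrite divr_gt0.
have [n nD] : exists n : nat, 1 < n%:R * (D / 2).
  exists (Num.truncn (D / 2)^-1).+1.
  by rewrite -ltr_pdivrMr// mul1r; apply: truncnS_gt.
(* All steps are shorter than [D], so [g] maps the partition to an [e]-chain. *)
have [|||t [[tp /eqP t1] tD]] := @fine_partition (D / 2) 0 1 n; [lra|lra|lra|].
apply: le_trans (_ : string_length d p (map g t) <= _)%E; last first.
  by apply: ereal_sup_ubound; exists t; rewrite ?gp//; split=> //; apply/eqP.
apply: ereal_inf_lbound; exists (map g t) => //; split.
- by case: t tp t1 {tD} => //= _ /eqP; rewrite eq_sym oner_eq0.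
- rewrite -gp path_map; apply: sub_path tD => u v /and4P[u0 uv vu v1] /=.
  by apply: gD; [lra|lra|rewrite distrC ger0_norm; lra].
- by rewrite -gp last_map t1.
Qed.

End emetric_theory.

(** * Chains parametrized by length *)

Section chain_paths.
Context (R : realType) (X : Type) (d : emetric R X).
Implicit Types (x y z p q : X) (a b e s t M L : R) (w : seq X).

(* The last point of the string [p :: w] at distance at most [t] from [p],
   measured along the string. *)
Fixpoint chain_path p w t : X :=
  if w is x :: w' then
    if t < fine (d p x) then p else chain_path x w' (t - fine (d p x))
  else p.

Lemma step_fineK e x y : (d x y <= e%:E)%E ->
  [/\ d x y = (fine (d x y))%:E, 0 <= fine (d x y) & fine (d x y) <= e].
Proof.
move=> xye; have xyfin : d x y \is a fin_num.
  by rewrite ge0_fin_numE ?emetric_ge0// (le_lt_trans xye)// ltry.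
by rewrite -!lee_fin fineK// emetric_ge0.
Qed.

Section steps.
Variables (e : R) (e0 : 0 < e).
Let step := fun x y => (d x y <= e%:E)%E.

(** Only steps of length zero are passed at such times, and they join equal points. *)
Lemma chain_path_le0 p w t : path step p w -> t <= 0 -> chain_path p w t = p.
Proof.
elim: w p t => //= x w IHw p t /andP[/step_fineK[pxE px0 _] xw] t0.
case: ltP => // pxt; have px : fine (d p x) = 0 by lra.
have -> : p = x by apply/(emetric_eq0 d); rewrite pxE px.
by rewrite IHw// emetricxx subr0.
Qed.

Lemma chain_path_start p w t : path step p w -> 0 <= t ->
  (eps_dist d e p (chain_path p w t) <= t%:E)%E.
Proof.
elim: w p t => /= [|x w IHw] p t; first by rewrite eps_distxx.
move=> /andP[pxe xw] t0; have [pxE px0 _] := step_fineK pxe.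
case: ltP => pxt; first by rewrite eps_distxx.
apply: (@le_trans _ _ (fine (d p x) + (t - fine (d p x)))%:E); last first.
  by rewrite lee_fin; lra.
apply: (@eps_dist_triangle_le _ _ _ _ x).
  by rewrite -pxE; exact: eps_dist_le.
by apply: IHw => //; rewrite subr_ge0.
Qed.

(** The path waits at a point until the time covers the whole next step, then jumps. It lags by at
    most one step, whence the term [e]. *)
Lemma chain_path_lipschitz p w s t : path step p w -> s <= t ->
  (eps_dist d e (chain_path p w s) (chain_path p w t) <= (t - s + e)%:E)%E.
Proof.
elim: w p s t => /= [|x w IHw] p s t.
  rewrite eps_distxx// lee_fin => _ st; have := e0; lra.
move=> /andP[pxe xw] st; have [pxE px0 pxe'] := step_fineK pxe.
have [spx|pxs] := ltP s; have [tpx|pxt] := ltP t.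
- by rewrite eps_distxx// lee_fin; lra.
- apply: (@le_trans _ _ (fine (d p x) + (t - fine (d p x)))%:E); last first.
    by rewrite lee_fin; lra.
  apply: (@eps_dist_triangle_le _ _ _ _ x).
    by rewrite -pxE; exact: eps_dist_le.
  by apply: chain_path_start => //; rewrite subr_ge0.
- by have := lt_le_trans tpx (le_trans pxs st); rewrite ltxx.
- by apply: le_trans (IHw _ _ _ xw _) _; rewrite ?lee_fin; lra.
Qed.

Lemma chain_path_end p w t : path step p w ->
  (string_length d p w <= t%:E)%E -> chain_path p w t = last p w.
Proof.
elim: w p t => //= x w IHw p t /andP[pxe xw].
have [pxE px0 pxe'] := step_fineK pxe.
rewrite /string_length/= big_cons => pwt.
have xwt : (string_length d x w <= (t - fine (d p x))%:E)%E.
  by rewrite EFinB leeBrDl// -pxE.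
rewrite IHw//; case: ltP => // tpx.
have := le_trans (string_length_ge0 d x w) xwt.
by rewrite lee_fin subr_ge0 leNgt tpx.
Qed.

Lemma eps_dist_path p q L : (eps_dist d e p q < L%:E)%E ->
  exists c : R -> X, [/\ forall t, t <= 0 -> c t = p, c L = q &
    forall s t, s <= t -> (eps_dist d e (c s) (c t) <= (t - s + e)%:E)%E].
Proof.
move=> /ereal_inf_lt[_ [w [_ pw <-] <-]] wL.
exists (chain_path p w); split=> [t t0||s t st].
- exact: chain_path_le0.
- exact/chain_path_end/ltW.
- exact: chain_path_lipschitz.
Qed.

End steps.

(** * Limits of chains under local compactness *)

Lemma ultra_path_cvg I (F : set_system I) (c : I -> R -> emetric_space d) M
    (p : emetric_space d) : UltraFilter F ->
  emetric_complete d -> locally_compact [set: emetric_space d] -> 0 <= M ->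
  c^~ 0 @ F --> p ->
  (forall eta, 0 < eta -> \forall i \near F, forall s t, s <= t ->
    (d (c i s) (c i t) <= (M * (t - s) + eta)%:E)%E) ->
  forall t, exists z : emetric_space d, c^~ t @ F --> z.
Proof.
move=> FU dC dL M0 cp cM.
have cM' eta : 0 < eta -> \forall i \near F, forall s t,
    (d (c i s) (c i t) <= (M * `|t - s| + eta)%:E)%E.
  move=> eta0; apply: filterS (cM _ eta0) => i ci s t.
  have [st|ts] := leP s t; first by rewrite ger0_norm ?subr_ge0//; exact: ci.
  by rewrite emetric_sym distrC ger0_norm ?subr_ge0 ?(ltW ts)//; exact/ci/ltW.
have M1 : 0 < M + 1 by lra.
have close eta s t : 0 < eta -> `|s - t| < eta / (M + 1) ->
    \forall i \near F, (d (c i s) (c i t) < (eta + eta)%:E)%E.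
  move=> eta0; rewrite ltr_pdivlMr// => st; apply: filterS (cM' _ eta0) => i ci.
  apply: le_lt_trans (ci s t) _; rewrite lte_fin distrC ltrD2r.
  by apply: le_lt_trans st; rewrite mulrC ler_wpM2l//; lra.
pose B := [set t | exists z : emetric_space d, c^~ t @ F --> z].
suff BT : B = [set: R] by move=> t; rewrite -[exists _, _]/(B t) BT.
have /connected_intervalP cR : is_interval [set: R] by [].
apply: cR; first by exists 0; exists p.
(* Openness: if the paths converge to [z] at time [t], then at nearby times they eventually stay in
   a compact neighbourhood of [z]. *)
- exists B; last by rewrite setTI.
  rewrite openE => t [z ctz]; have [U] := dL z Logic.I.
  rewrite withinET => /nbhs_ballP[D /= D0 DU] [cU _].
  have D3 : 0 < D / 3 by rewrite divr_gt0.
  apply/nbhs_ballP; exists (D / 3 / (M + 1)) => [|s].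
    by rewrite /= divr_gt0.
  rewrite -ball_normE /ball_ /= => ts; apply: (ultra_compact_cvg FU cU).
  apply: filterS2 (close _ _ _ D3 ts) ((cvg_ballP _ _).1 ctz _ D3) => i cts zct.
  apply: DU; rewrite [D](_ : _ = D / 3 + (D / 3 + D / 3)); last lra.
  exact: ball_triangle zct cts.
(* Closedness: the limit at a nearby time [s] in [B] is the centre of a small ball that eventually
   contains the points at time [t], so completeness applies. *)
- exists B; last by rewrite setTI.
  move=> t /= tB.
  suff : cauchy_ex (c^~ t @ F) by apply: complete_cauchy_ex.
  move=> e e0; have e3 : 0 < e / 3 by rewrite divr_gt0.
  have [s [[z csz]]] := tB _ (nbhsx_ballx t _ (divr_gt0 e3 M1)).
  rewrite -ball_normE /ball_ /= distrC => st; exists z.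
  apply: filterS2 (close _ _ _ e3 st) ((cvg_ballP _ _).1 csz _ e3) => i cst zcs.
  rewrite [e](_ : _ = e / 3 + (e / 3 + e / 3)); last lra.
  exact: ball_triangle zcs cst.
Qed.

Lemma locally_compact_path p q :
  emetric_complete d -> locally_compact [set: emetric_space d] ->
  (chain_dist d p q < +oo)%E ->
  exists g : R -> X, [/\ g 0 = p, g 1 = q & forall s t, s <= t ->
    (chain_dist d (g s) (g t) <= (fine (chain_dist d p q) * (t - s))%:E)%E].
Proof.
move=> dC dL pqoo; set L := fine _.
have pqL : chain_dist d p q = L%:E.
  by rewrite /L fineK// ge0_fin_numE ?chain_dist_ge0.
have L0 : 0 <= L by rewrite -lee_fin -pqL chain_dist_ge0.
(* The filter lives on all of [R]; the constant path is a default value for [e <= 0]. *)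
have /choice[c cP] (e : R) : exists c : R -> X, 0 < e -> [/\
    forall t, t <= 0 -> c t = p, c (L + e) = q &
    forall s t, s <= t -> (eps_dist d e (c s) (c t) <= (t - s + e)%:E)%E].
  have [e0|e0] := ltP 0 e; last by exists (fun=> p).
  have [|c cP] := @eps_dist_path e e0 p q (L + e); last by exists c.
  apply: le_lt_trans (eps_dist_le_chain d p q e0) _.
  by rewrite pqL lte_fin; lra.
have [F [FU F0]] := ultraFilterLemma (at_right_proper_filter (0 : R)).
have smallF eta : 0 < eta -> \forall e \near F, 0 < e < eta.
  move=> eta0; apply: F0.
  by apply: filterS2 (nbhs_right_gt 0) (nbhs_right_lt eta0) => e -> ->.
pose h (e t : R) : emetric_space d := c e (L * t).
have hL e eta : 0 < e -> 0 < eta -> \forall i \near F, forall s t, s <= t ->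
    (eps_dist d e (h i s) (h i t) <= (L * (t - s) + eta)%:E)%E.
  move=> e0 eta0; have k0 : 0 < Num.min e eta by rewrite lt_min e0.
  apply: filterS (smallF _ k0) => i /andP[i0]; rewrite lt_min => /andP[ie ieta].
  move=> s t st; have [_ _ /(_ (L * s) (L * t))] := cP i i0.
  rewrite ler_wpM2l// => /(_ isT) ci.
  apply: le_trans (le_eps_dist d _ _ (ltW ie)) _.
  by apply: le_trans ci _; rewrite lee_fin mulrBr; lra.
have h0 : h^~ 0 @ F --> (p : emetric_space d).
  apply/cvg_ballP => e e0; apply: filterS (smallF _ e0) => i /andP[i0 _].
  by have [c0 _ _] := cP i i0; rewrite /h mulr0 c0//; apply: ballxx.
(* [h i 1] is the point at parameter [L], while [q] is reached at [L + i]; their distance is at most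
   [2 * i]. *)
have h1 : h^~ 1 @ F --> (q : emetric_space d).
  apply/cvg_ballP => e e0; have e2 : 0 < e / 2 by rewrite divr_gt0.
  apply: filterS (smallF _ e2) => i /andP[i0 ie].
  have [_ <- /(_ L (L + i))] := cP i i0; rewrite lerDl ltW// => /(_ isT) ci.
  rewrite /h mulr1 emetric_ballE emetric_sym.
  apply: le_lt_trans (eps_dist_ge d i _ _) _; apply: le_lt_trans ci _.
  by rewrite lte_fin; lra.
apply: (@limit_path _ _ _ _ F _ h) => //.
apply: (ultra_path_cvg FU dC dL L0 h0) => eta eta0.
apply: filterS (hL 1 _ ltr01 eta0) => i hi s t st.
by apply: le_trans (eps_dist_ge d 1 _ _) _; exact: hi.
Qed.

End chain_paths.

(** * Iterated bisection with approximate midpoints *)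

Section bisection.
Context (R : realType) (X : Type) (d : emetric R X).
Implicit Types (x y : X) (s t L : R) (n m : nat).
Variable mid : X -> X -> R -> X.
Hypothesis midP : forall x y L, (d x y < L%:E)%E ->
  (d x (mid x y L) < (L / 2)%:E)%E /\ (d (mid x y L) y < (L / 2)%:E)%E.

(** Stage [n] is a step function on the dyadic intervals of length 2^-n, whose value is the point
    assigned to the left endpoint. At [t = 1] it is thus still one interval short of [y]. *)
Fixpoint bisect n x y L t : X :=
  if n is m.+1 then
    if t < 1 / 2 then bisect m x (mid x y L) (L / 2) (2 * t)
    else bisect m (mid x y L) y (L / 2) (2 * t - 1)
  else x.

Let half_pow L n : L / 2 / 2 ^+ n = L / 2 ^+ n.+1.
Proof. by rewrite exprS invfM mulrA. Qed.

Let bound_gt0 x y L : (d x y < L%:E)%E -> 0 < L.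
Proof. by move=> xyL; rewrite -lte_fin (le_lt_trans (emetric_ge0 d x y)). Qed.

Lemma bisect0 n x y L : bisect n x y L 0 = x.
Proof.
elim: n y L => //= n IHn y L.
by rewrite ifT ?mulr0//; lra.
Qed.

Lemma bisect_start n x y L t : (d x y < L%:E)%E -> 0 <= t <= 1 ->
  (d x (bisect n x y L t) <= (L * t)%:E)%E.
Proof.
elim: n x y L t => /= [|n IHn] x y L t xyL t01.
  have L0 := bound_gt0 xyL; case/andP: t01 => t0 _.
  by rewrite emetricxx lee_fin mulr_ge0// ltW.
have [xz zy] := midP xyL; case: ltP => t2.
  apply: le_trans (IHn _ _ _ _ xz _) _; first lra.
  by rewrite lee_fin mulrA divfK// pnatr_eq0.
have h01 : 0 <= 2 * t - 1 <= 1 by lra.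
apply: le_trans (emetric_triangle_le (ltW xz) (IHn _ _ _ _ zy h01)) _.
by rewrite lee_fin; lra.
Qed.

(** The value may lag behind [t] by one dyadic interval, which costs [L / 2 ^+ n]; measured from
    [x], the lag costs nothing. *)
Lemma bisect_end n x y L t : (d x y < L%:E)%E -> 0 <= t <= 1 ->
  (d (bisect n x y L t) y <= (L * (1 - t) + L / 2 ^+ n)%:E)%E.
Proof.
elim: n x y L t => /= [|n IHn] x y L t xyL t01.
  have L0 := bound_gt0 xyL; case/andP: t01 => _ t1.
  apply: le_trans (ltW xyL) _.
  by rewrite lee_fin expr0 divr1 lerDr mulr_ge0 ?subr_ge0// ltW.
have [xz zy] := midP xyL; case: ltP => t2.
  have h01 : 0 <= 2 * t <= 1 by lra.
  apply: le_trans (emetric_triangle_le (IHn _ _ _ _ xz h01) (ltW zy)) _.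
  by rewrite lee_fin half_pow; lra.
apply: le_trans (IHn _ _ _ _ zy _) _; first lra.
by rewrite lee_fin half_pow; lra.
Qed.

Lemma bisect_lipschitz n x y L s t : (d x y < L%:E)%E ->
  0 <= s -> s <= t -> t <= 1 ->
  (d (bisect n x y L s) (bisect n x y L t) <= (L * (t - s) + L / 2 ^+ n)%:E)%E.
Proof.
elim: n x y L s t => /= [|n IHn] x y L s t xyL s0 st t1.
  have L0 := bound_gt0 xyL.
  rewrite emetricxx lee_fin expr0 divr1.
  by rewrite addr_ge0 ?(ltW L0)// mulr_ge0 ?subr_ge0// ltW.
have [xz zy] := midP xyL.
have [s2|s2] := ltP s; have [t2|t2] := ltP t.
- apply: le_trans (IHn _ _ _ _ _ xz _ _ _) _; [lra|lra|lra|].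
  by rewrite lee_fin half_pow; lra.
(* For times in different halves the estimate goes through the midpoint. *)
- have s01 : 0 <= 2 * s <= 1 by lra.
  have t01 : 0 <= 2 * t - 1 <= 1 by lra.
  apply: le_trans (emetric_triangle_le (bisect_end n xz s01)
    (bisect_start n zy t01)) _.
  by rewrite lee_fin half_pow; lra.
- by have := lt_le_trans t2 (le_trans s2 st); rewrite ltxx.
- apply: le_trans (IHn _ _ _ _ _ zy _ _ _) _; [lra|lra|lra|].
  by rewrite lee_fin half_pow; lra.
Qed.

(** Later stages only subdivide the dyadic interval that starts at the value of stage [n] and has
    bound [L / 2 ^+ n]. *)
Lemma bisect_cauchy n m x y L t : (d x y < L%:E)%E -> 0 <= t <= 1 ->
  (d (bisect n x y L t) (bisect (n + m) x y L t) <= (L / 2 ^+ n)%:E)%E.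
Proof.
elim: n x y L t => /= [|n IHn] x y L t xyL t01.
  apply: le_trans (bisect_start m xyL t01) _.
  have L0 := bound_gt0 xyL; case/andP: t01 => _ t1.
  by rewrite lee_fin expr0 divr1 ler_piMr// ltW.
have [xz zy] := midP xyL; rewrite -half_pow.
by case: ltP => t2; apply: IHn => //; lra.
Qed.

End bisection.

(** * Bisection for the chain distance *)

Section chain_bisection.
Context (R : realType) (X : Type).
Implicit Types (d : emetric R X) (x y z p q : X) (s t L : R) (n m : nat).

(** The point halfway along a nearly optimal chain. Both halves are bounded in [d] only; applied to
    [chain_emetric d], the lemma bounds them in [chain_dist d]. *)
Lemma chain_midpoint d x y L : (chain_dist d x y < L%:E)%E ->
  exists z, (d x z < (L / 2)%:E)%E /\ (d z y < (L / 2)%:E)%E.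
Proof.
move=> xyL.
have [l [xyl lL]] : exists l, (chain_dist d x y < l%:E)%E /\ l < L.
  have xyfin : chain_dist d x y \is a fin_num.
    by rewrite ge0_fin_numE ?chain_dist_ge0// (lt_trans xyL)// ltry.
  move: xyL; rewrite -(fineK xyfin) lte_fin => xyL.
  by exists ((fine (chain_dist d x y) + L) / 2); rewrite lte_fin; lra.
have l0 : 0 < l by rewrite -lte_fin (le_lt_trans (chain_dist_ge0 d x y)).
(* Each half costs at most [l / 2 + e], which is less than [L / 2]. *)
pose e := (L - l) / 4.
have e0 : 0 < e by rewrite /e; lra.
have [|c [c0 <- cl]] := @eps_dist_path _ _ d e e0 x y l.
  by apply: le_lt_trans xyl; exact: eps_dist_le_chain.
exists (c (l / 2)); split; apply: le_lt_trans (eps_dist_ge d e _ _) _.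
  rewrite -(c0 0)//; apply: le_lt_trans (cl _ _ _) _; first lra.
  by rewrite lte_fin /e; lra.
apply: le_lt_trans (cl _ _ _) _; first lra.
by rewrite lte_fin /e; lra.
Qed.

Lemma complete_chain_path d p q L : emetric_complete d ->
  (forall x y, chain_dist (chain_emetric d) x y = chain_dist d x y) ->
  (chain_dist d p q < L%:E)%E ->
  exists g : R -> X, [/\ g 0 = p, g 1 = q & forall s t, s <= t ->
    (chain_dist d (g s) (g t) <= (L * (t - s))%:E)%E].
Proof.
move=> dC dd pqL.
have /choice[mid midP] (v : X * X * R) : exists z,
    (chain_dist d v.1.1 v.1.2 < v.2%:E)%E ->
    (chain_dist d v.1.1 z < (v.2 / 2)%:E)%E /\
    (chain_dist d z v.1.2 < (v.2 / 2)%:E)%E.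
  case: v => -[x y] l /=; have [xyl|] := pselect (chain_dist d x y < l%:E)%E.
    have [|z zP] := @chain_midpoint (chain_emetric d) x y l.
      by rewrite dd.
    by exists z.
  by exists p.
pose mi x y l := mid (x, y, l).
have miP x y l : (chain_emetric d x y < l%:E)%E ->
  (chain_emetric d x (mi x y l) < (l / 2)%:E)%E /\
  (chain_emetric d (mi x y l) y < (l / 2)%:E)%E := midP (x, y, l).
(* The bisection estimates hold on [0, 1]; clamping extends them to all times. *)
pose clamp t := Num.max 0 (Num.min 1 t).
pose c n t : emetric_space d := bisect mi n p q L (clamp t).
have L0 : 0 < L by rewrite -lte_fin (le_lt_trans (chain_dist_ge0 d p q)).
have small e : 0 < e -> \forall n \near \oo, L / 2 ^+ n < e.
  move=> e0; have eL0 : 0 < e / L by rewrite divr_gt0.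
  apply: filterS (near_infty_natSinv_expn_lt (PosNum eL0)) => n /=.
  by rewrite div1r ltr_pdivlMr// mulrC.
have cl01 t : 0 <= clamp t <= 1.
  by rewrite /clamp le_max lexx ge_max ler01 ge_min lexx.
have cll s t : s <= t -> 0 <= clamp t - clamp s <= t - s.
  have clampE u : [\/ u <= 0 /\ clamp u = 0, 0 <= u <= 1 /\ clamp u = u |
      1 <= u /\ clamp u = 1].
    rewrite /clamp; have [u1|u1] := leP 1 u.
      by constructor 3; rewrite (max_idPr _).
    by have [u0|u0] := leP 0 u; [constructor 2|constructor 1]; rewrite ltW.
  by case: (clampE s) => -[? ->]; case: (clampE t) => -[? ->] ?; lra.
(* The stages are Cauchy for [chain_dist d], hence for the smaller metric [d], which is the complete
   one. *)
have cc n m t : (n <= m)%N -> (d (c n t) (c m t) <= (L / 2 ^+ n)%:E)%E.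
  move=> nm; apply: le_trans (chain_dist_ge d _ _) _.
  by rewrite /c -(subnKC nm); exact: (bisect_cauchy miP).
apply: (@limit_path _ _ d _ \oo _ c).
- move=> t; suff : cauchy_ex (c^~ t @ \oo) by apply: complete_cauchy_ex.
  move=> e e0; have [N _ NL] := small e e0.
  exists (c N t); exists N => // m /= Nm.
  by rewrite emetric_ballE (le_lt_trans (cc _ _ _ Nm))// lte_fin NL/=.
- apply/cvg_ballP => e e0; apply: nearW => n.
  have -> : c n 0 = p; last exact: ballxx.
  by rewrite /c /clamp (min_idPr _)// maxxx bisect0.
- apply/cvg_ballP => e e0; apply: filterS (small _ e0) => n nL.
  rewrite emetric_ballE emetric_sym /c /clamp minxx (max_idPr _)//.
  apply: le_lt_trans (chain_dist_ge d _ _) _.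
  apply: le_lt_trans (bisect_end miP n pqL _) _; first by rewrite ler01 lexx.
  by rewrite subrr mulr0 add0r lte_fin.
- move=> e eta e0 eta0; apply: filterS (small _ eta0) => n nL s t st.
  apply: le_trans (eps_dist_le_chain d _ _ e0) _.
  have [cs01 ct01] := (cl01 s, cl01 t); have := cll s t st.
  move=> cst.
  apply: le_trans (bisect_lipschitz miP n pqL _ _ _) _; [lra|lra|lra|].
  rewrite lee_fin lerD//; last exact: ltW.
  by rewrite ler_wpM2l; [|lra|lra].
Qed.

End chain_bisection.

End chain_distance.

Theorem theorem1p6 (R : realType) (X : Type) (d : emetric R X) :
  [\/ emetric_complete d /\ locally_compact [set: emetric_space d],
      emetric_complete d /\
        (forall p q : X,
           chain_emetric (chain_emetric d) p q = chain_emetric d p q)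
    | forall p q : X, length_dist d p q = d p q] ->
  (forall p q : X, chain_emetric d p q = length_dist d p q) /\
  (emetric_complete d /\ locally_compact [set: emetric_space d] ->
   geodesic (chain_emetric d)).
Proof.
move=> dP; split=> [p q|[dC dL] p q pq]; last first.
  (* The Lipschitz constant is the distance itself, so the length cannot exceed it. *)
  have [g [g0 g1 gL]] := locally_compact_path dC dL pq.
  have [gj gle] := @lipschitz_joining_path _ _ (chain_emetric d) g _ gL.
  rewrite g0 g1 in gj; exists g => //; apply: le_anti.
  rewrite (le_path_length gj) andbT (le_trans gle)// fineK//.
  by rewrite ge0_fin_numE//; exact: chain_dist_ge0.
apply: le_anti; apply/andP; split.
  by apply: le_ereal_inf_tmp => _ [g gpq <-]; exact: chain_dist_le_path_length.
have [->|pqoo] := eqVneq (chain_emetric d p q) +oo%E; first exact: leey.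
have pqfin : chain_dist d p q \is a fin_num.
  by rewrite ge0_fin_numE ?chain_dist_ge0// ltey.
case: dP => [[dC dL]|[dC dd]|dl].
- have [|g [g0 g1 gL]] := @locally_compact_path _ _ d p q dC dL.
    by rewrite ltey.
  by rewrite /= -[leRHS]fineK//; exact: length_dist_le gL.
(* Bisection starts from a strict bound on the distance, hence the extra [e]. *)
- apply/lee_addgt0Pr => e e0; rewrite /= -[chain_dist d p q]fineK// -EFinD.
  have [||g [g0 g1 gL]] :=
    @complete_chain_path _ _ d p q (fine (chain_dist d p q) + e) dC.
  + exact: dd.
  + by rewrite EFinD fineK// lteDl.
  exact: length_dist_le gL.
- by rewrite dl; exact: chain_dist_ge.
Qed.
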